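(* Let $m\in(0,2)$ and let $2\le\ell_N\le N$ be an integer. For any $\rho\in[0,1]$, the Bernoulli product measure $\nu_\rho^N$ on $\Omega_N$, with marginals $\nu^N_\rho(\eta(x)=1)=\rho$ for $x\in\mathbb{T}_N$, is invariant for the Markov process generated by $\mathcal{L}_N^{(m-1)}$. Moreover, for any $k\in\{0,\dots,N\}$, the hyperplane $$\mathscr{H}_{N,k}=\Big\{\eta\in\Omega_N:\ \sum_{x\in\mathbb{T}_N}\eta(x)=k\Big\}$$ is irreducible under the Markov process generated by $\mathcal{L}_N^{(m-1)}$ (that is, any configuration of $\mathscr{H}_{N,k}$ can be changed into any other one through successive jumps that have positive rate).
   Context: $\mathbb{T}_N=\mathbb{Z}/N\mathbb{Z}$, $\Omega_N=\{0,1\}^{\mathbb{T}_N}$; sites are read modulo $N$. $\eta^{x,y}$ is $\eta$ with the values at $x$ and $y$ exchanged, $(\nabla_{x,y}f)(\eta)=f(\eta^{x,y})-f(\eta)$, $(\tau_x\eta)(y)=\eta(x+y)$, $\overline{\eta}(x)=1-\eta(x)$. Put $\mathbf{a}(\eta)=\eta(0)(1-\eta(1))+\eta(1)(1-\eta(0))$, $\mathbf{a}_{x,x+1}(\eta)=\mathbf{a}(\tau_x\eta)$. For integers $k\ge0$ and $1\le j\le k+1$, $$\mathbf{s}^{(k)}_j(\eta)=\prod_{\substack{i=-(k+1)+j\\ i\ne0,1}}^{j}\eta(i),\qquad \mathbf{c}^{(k)}(\eta)=\sum_{j=1}^{k+1}\mathbf{s}_j^{(k)}(\eta)$$ (product over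 integers $i$; $\mathbf{c}^{(0)}\equiv1$). With $\binom{m}{k}=\frac{m(m-1)\cdots(m-k+1)}{k!}$, $$c_N^{(m-1)}(\eta)=\sum_{k=1}^{\ell_N}\binom{m}{k}(-1)^{k-1}\mathbf{c}^{(k-1)}(\overline{\eta}),\qquad (\mathcal{L}_N^{(m-1)}f)(\eta)=\sum_{x\in\mathbb{T}_N}c_N^{(m-1)}(\tau_x\eta)\,\mathbf{a}_{x,x+1}(\eta)\,(\nabla_{x,x+1}f)(\eta).$$ *)

(* Defs.v *)
From mathcomp Require Import all_boot all_order all_algebra all_fingroup.
From mathcomp Require Import boolp classical_sets reals topology normedtype.
From mathcomp Require Import sequences bernoulli_distribution.

Set Implicit Arguments.
Unset Strict Implicit.
Unset Printing Implicit Defensive.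

Import Order.TTheory GRing.Theory Num.Theory.
Import numFieldNormedType.Exports.

Local Open Scope ring_scope.

(* The torus Z/NZ is the ring 'Z_N, which has N elements only for N > 1. *)
Definition config (N : nat) := {ffun 'Z_N -> bool}.

Section Configurations.
Variable N : nat.
Implicit Types (eta : config N) (x y : 'Z_N).

Definition exchange eta x y : config N := [ffun z => eta (tperm x y z)].

Definition shift x eta : config N := [ffun y => eta (x + y)].

Definition flip eta : config N := [ffun x => ~~ eta x].

Definition hyperplane (k : nat) : {set config N} :=
  [set eta : config N | (\sum_(x : 'Z_N) eta x)%N == k].

End Configurations.

Section FinitePorousMedium.
Variables (R : realType) (N : nat).
Implicit Types (eta : config N) (f : config N -> R).

Definition occ eta (x : 'Z_N) : R := (eta x)%:R.

Definition nabla (x y : 'Z_N) f eta : R := f (exchange eta x y) - f eta.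

Definition a_rate eta : R :=
  occ eta 0 * (1 - occ eta 1) + occ eta 1 * (1 - occ eta 0).

(* The integer i ranges over -(k+1)+j, ..., j and is written -(k+1)+j+d with
   0 <= d <= k+1. It is compared with 0 and 1 before reduction modulo N. *)
Definition window (k j d : nat) : int := - (k.+1)%:Z + j%:Z + d%:Z.

Definition s_prod (k j : nat) eta : R :=
  \prod_(d < k.+2 | (window k j d != 0) && (window k j d != 1))
    occ eta (window k j d)%:~R.

Definition c_pmm (k : nat) eta : R := \sum_(1 <= j < k.+2) s_prod k j eta.

Definition gbinom (m : R) (k : nat) : R :=
  (\prod_(i < k) (m - i%:R)) / (k`!)%:R.

Definition c_rate (m : R) (l : nat) eta : R :=
  \sum_(1 <= k < l.+1) gbinom m k * (-1) ^+ k.-1 * c_pmm k.-1 (flip eta).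

Definition generator (m : R) (l : nat) f eta : R :=
  \sum_(x : 'Z_N)
    c_rate m l (shift x eta) * a_rate (shift x eta) * nabla x (x + 1) f eta.

Definition bernoulli_product (rho : R) eta : R :=
  \prod_(x : 'Z_N) bernoulli_pmf rho (eta x).

End FinitePorousMedium.

Section FiniteMarkovProcess.
Variables (R : realType) (S : finType).
Implicit Types (L : (S -> R) -> S -> R) (f nu : S -> R).

(* On a finite state space the process generated by L has transition semigroup
   P_t = exp(tL), i.e. (P_t f)(s) = sum_n t^n / n! (L^n f)(s). *)
Definition semigroup L (t : R) f (s : S) : R :=
  limn (series (fun n => exp_coeff t n * iter n L f s)).

(* The measure nu is given by its mass function. *)
Definition integral_pmf nu f : R := \sum_(s : S) nu s * f s.

Definition invariant_measure L nu : Prop :=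
  forall (t : R) f, 0 <= t ->
    integral_pmf nu (semigroup L t f) = integral_pmf nu f.

(* For s != s', the rate of the jump s -> s' is the off-diagonal entry
   (L 1_{s'})(s) of the generator. *)
Definition jump_rate L (s s' : S) : R := L (fun u => (u == s')%:R) s.

Definition positive_jump L : rel S :=
  fun s s' => (s != s') && (0 < jump_rate L s s').

Definition irreducible_class L (A : {set S}) : Prop :=
  {in A &, forall s s', connect (positive_jump L) s s'}.

End FiniteMarkovProcess.

(* Main.v *)
(* For fixed [x] the rate of the exchange across [{x, x + 1}] does not change
   when the two values are exchanged, and neither does the weight of the
   Bernoulli measure. Hence the generator has mean zero under that measure, and
   so does every term but the first of the exponential series of the semigroup.
   Invariance of the rate needs care only for the last term of [c_rate] when
   [l = N]: there the two extreme windows wrap around and meet the sites 1 and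
   0; the exchange swaps them.

   For the irreducibility it suffices that [c_rate > 0]. If [m <= 1] all of its
   coefficients are nonnegative and the first is [m]. If [m > 1] the others are
   negative, and [c_pmm k <= k + 1] with [(k+1) binom(m, k+1) = m binom(m-1, k)]
   gives
     [c_rate >= m sum_(k < l) (-1)^k binom(m-1, k)
              = m (-1)^(l-1) binom(m-2, l-1) > 0].
   So every adjacent exchange is available, and these generate all exchanges. *)
From mathcomp Require Import all_boot all_order all_algebra all_fingroup.
From mathcomp Require Import boolp classical_sets reals topology normedtype.
From mathcomp Require Import sequences bernoulli_distribution.
From mathcomp Require Import ring lra zify.
Require Import Defs.

Set Implicit Arguments.
Unset Strict Implicit.
Unset Printing Implicit Defensive.

Import Order.TTheory GRing.Theory Num.Theory.
Import numFieldNormedType.Exports.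
Local Open Scope ring_scope.

(** * Binomial coefficients with real upper index *)

Lemma alternating_gbinom_sum (R : realType) (m : R) (n : nat) :
  \sum_(k < n.+1) (-1) ^+ k * gbinom m k = (-1) ^+ n * gbinom (m - 1) n.
Proof.
elim: n => [|n IH].
  by rewrite big_ord_recr big_ord0 /= add0r /gbinom !big_ord0.
rewrite big_ord_recr IH /= /gbinom.
rewrite big_ord_recl [in RHS]big_ord_recr /=.
under [X in _ * X / _]eq_bigr => i _ do rewrite /bump /= natrD opprD addrA.
rewrite exprS subr0 factS natrM invfM.
have f0 : (n`!)%:R != 0 :> R by rewrite pnatr_eq0 -lt0n fact_gt0.
have n0 : n.+1%:R != 0 :> R by rewrite pnatr_eq0.
(* All three binomial coefficients are multiples of [p], the product of [m - 1], ..., [m - n]. *)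
set p := \prod_(_ < n) _.
rewrite -[n.+1]addn1 natrD in n0 *.
by field; rewrite f0 n0.
Qed.

(** Each of the [k] factors [x - i] is negative and absorbs one sign. *)
Lemma alternating_gbinom_gt0 (R : realType) (x : R) (k : nat) :
  x < 0 -> 0 < (-1) ^+ k * gbinom x k.
Proof.
move=> x0; rewrite /gbinom mulrA -{1}(card_ord k) -prodrN; apply: divr_gt0.
  by apply: prodr_gt0 => i _; have := ler0n R i; lra.
by rewrite ltr0n fact_gt0.
Qed.

Lemma gbinom_recr (R : realType) (m : R) (k : nat) :
  gbinom m k.+1 = m / k.+1%:R * gbinom (m - 1) k.
Proof.
rewrite /gbinom big_ord_recl /=.
under eq_bigr => i _ do rewrite /bump /= natrD opprD addrA.
by rewrite subr0 factS natrM invfM; ring.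
Qed.

(** * Positivity of the rates *)

Section Rates.
Variables (R : realType) (N : nat).
Implicit Types eta : config N.

Lemma s_prod_ge0 k j eta : 0 <= s_prod R k j eta.
Proof. by apply: prodr_ge0 => d _; rewrite ler0n. Qed.

Lemma s_prod_le1 k j eta : s_prod R k j eta <= 1.
Proof.
by apply: prodr_ile1 => d _; rewrite /occ; case: (eta _); rewrite ?ler01 ?lexx.
Qed.

Lemma c_pmm_ge0 k eta : 0 <= c_pmm R k eta.
Proof. by apply: sumr_ge0 => j _; exact: s_prod_ge0. Qed.

Lemma c_pmm_le k eta : c_pmm R k eta <= k.+1%:R.
Proof.
rewrite /c_pmm; apply: le_trans (ler_sum _ (fun j _ => s_prod_le1 k j eta)) _.
by rewrite sumr_const_nat subn1.
Qed.

Lemma c_pmm0 eta : c_pmm R 0 eta = 1.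
Proof.
by rewrite /c_pmm big_nat1 /s_prod big_mkcond !big_ord_recl big_ord0 /= !mulr1.
Qed.

Lemma c_rate_gt0 (m : R) (l : nat) eta : 0 < m < 2 -> (0 < l)%N ->
  0 < c_rate m l eta.
Proof.
case: l => // l /andP[m0 m2] _.
rewrite /c_rate big_add1 big_mkord /=.
have -> : \sum_(i < l.+1) gbinom m i.+1 * (-1) ^+ i * c_pmm R i (flip eta)
  = m * \sum_(i < l.+1) (-1) ^+ i * gbinom (m - 1) i *
      (c_pmm R i (flip eta) / i.+1%:R).
  rewrite mulr_sumr; apply: eq_bigr => i _.
  rewrite gbinom_recr; ring.
apply: mulr_gt0 => //.
pose r (i : nat) := c_pmm R i (flip eta) / i.+1%:R.
have r01 i : 0 <= r i <= 1.
  by rewrite divr_ge0 ?c_pmm_ge0 //= ler_pdivrMr ?ltr0n // mul1r c_pmm_le.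
(* As [m - 2 < 0], every coefficient after the first has the sign of [1 - m]. *)
have sgn i : (-1) ^+ i.+1 * gbinom (m - 1) i.+1
   = (1 - m) * (((-1) ^+ i * gbinom (m - 1 - 1) i) / i.+1%:R).
  by rewrite gbinom_recr exprS; ring.
have pos i : 0 < ((-1) ^+ i * gbinom (m - 1 - 1) i) / i.+1%:R.
  by rewrite divr_gt0 ?ltr0n // alternating_gbinom_gt0 //; lra.
have [m1|m1] := leP m 1.
  rewrite big_ord_recl /= expr0 /gbinom big_ord0 c_pmm0 fact0 !divr1 !mul1r.
  apply: ltr_wpDr => //; apply: sumr_ge0 => i _; rewrite -/(gbinom _ _) sgn.
  apply: mulr_ge0; last by have /andP[] := r01 (bump 0 i).
  by rewrite mulr_ge0 ?subr_ge0 // ltW.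
(* Those coefficients are now negative, so replacing each [r i] by 1 only lowers the sum. *)
apply: (@lt_le_trans _ _ (\sum_(i < l.+1) (-1) ^+ i * gbinom (m - 1) i)).
  by rewrite alternating_gbinom_sum alternating_gbinom_gt0 //; lra.
apply: ler_sum => -[[|i] /= _] _.
  by rewrite c_pmm0 divr1 mulr1.
have /andP[r0 r1] := r01 i.+1; rewrite sgn -/(r i.+1).
have := pos i; set p := (_ / _) => p0.
have : 0 <= ((m - 1) * p) * (1 - r i.+1).
  by rewrite mulr_ge0 ?subr_ge0 // mulr_ge0 ?subr_ge0 // ltW.
lra.
Qed.
End Rates.

(** Windows avoid 0 and 1 as integers; this carries the avoidance over to the torus. *)
Lemma intr_Zp_neq0 (N : nat) (w : int) : (1 < N)%N -> w != 0 -> (`|w| < N)%N ->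
  w%:~R != 0 :> 'Z_N.
Proof.
move=> N1 w0 wN.
have abs0 : (`|w|%N)%:R != 0 :> 'Z_N.
  by rewrite -(inj_eq val_inj) [val _]val_Zp_nat // modn_small // absz_eq0.
case: w {w0 wN} abs0 => n //=.
by rewrite NegzE mulrNz oppr_eq0.
Qed.

(** * Symmetry under exchanges *)

Section Exchange.
Variables (R : realType) (N : nat).
Hypothesis N1 : (1 < N)%N.
Implicit Types eta : config N.

Lemma s_prod_nat k j eta :
  s_prod R k j eta =
    \prod_(0 <= d < k.+2 | (window k j d != 0) && (window k j d != 1))
      occ R eta (window k j d)%:~R.
Proof. by rewrite /s_prod big_mkord. Qed.

(** No factor sits at site 0 or 1, even modulo [N]. For [k.+1 = N] this requires leaving out the two
    extreme values of [j]. *)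
Lemma s_prod_exchange k j eta : (0 < j <= k.+1)%N ->
  (k.+1 < N)%N || (1 < j <= k)%N && (k < N)%N ->
  s_prod R k j (exchange eta 0 1) = s_prod R k j eta.
Proof.
move=> jk kN; apply: eq_bigr => d /andP[d0 d1].
rewrite /occ ffunE tpermD // eq_sym.
  by apply: intr_Zp_neq0 => //; have := ltn_ord d; move: d0; rewrite /window; lia.
rewrite -subr_eq0 -(rmorphB intr _ 1).
apply: intr_Zp_neq0 => //; first by rewrite subr_eq0.
by have := ltn_ord d; move: d1; rewrite /window; lia.
Qed.

(* When [k + 1 = N] the first window wraps around to site 1 and the last one to
   site 0. *)
Lemma s_prod_exchange_wrap k eta : k.+1 = N ->
  s_prod R k 1 (exchange eta 0 1) = s_prod R k k.+1 eta.
Proof.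
move=> kN; have k0 : (0 < k)%N by lia.
have NZ : (k.+1)%:R = 0 :> 'Z_N by rewrite kN pchar_Zp.
(* The integers [-k], ..., [-1] reduce to the sites 1, ..., [k]. *)
have -> : s_prod R k 1 (exchange eta 0 1) =
    \prod_(0 <= d < k) occ R (exchange eta 0 1) (d.+1%:R).
  rewrite s_prod_nat big_mkcond 2?big_nat_recr //= /window.
  rewrite [X in X && _](_ : _ = false); last by lia.
  rewrite [X in _ * _ * (if X then _ else _)](_ : _ = false); last by lia.
  rewrite !mulr1; apply: eq_big_nat => d /andP[_ dk].
  rewrite ifT; last by lia.
  congr (occ _ _ _).
  have -> : - (k.+1)%:Z + 1%:Z + d%:Z = d.+1%:Z - k.+1%:Z by lia.
  by rewrite rmorphB /= -!pmulrn NZ subr0.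
(* Here the sites are 2, ..., [k.+1], the last of which is 0. *)
have -> : s_prod R k k.+1 eta = \prod_(0 <= d < k) occ R eta (d.+2%:R).
  rewrite s_prod_nat big_mkcond 2?big_nat_recl //= /window.
  rewrite [X in X && _](_ : _ = false); last by lia.
  rewrite [X in _ * ((if X then _ else _) * _)](_ : _ = false); last by lia.
  rewrite !mul1r; apply: eq_big_nat => d /andP[_ dk].
  rewrite ifT; last by lia.
  congr (occ _ _ _).
  have -> : - (k.+1)%:Z + k.+1%:Z + d.+2%:Z = d.+2%:Z by lia.
  by [].
case: k k0 kN NZ => // k _ kN NZ.
rewrite big_nat_recl // [RHS]big_nat_recr //= NZ mulrC.
congr (_ * _); last by rewrite /occ ffunE tpermR.
apply: eq_big_nat => d dk; rewrite /occ ffunE tpermD // eq_sym.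
  by apply: (@intr_Zp_neq0 _ d.+2) => //; lia.
rewrite -subr_eq0 -(natrB _ (isT : 0 < d.+2)%N).
by apply: (@intr_Zp_neq0 _ d.+1) => //; lia.
Qed.

Lemma exchangeK x y : involutive (fun eta => exchange eta x y).
Proof. by move=> eta; apply/ffunP => z; rewrite !ffunE tpermK. Qed.

(** Each summand is fixed, except that for [k.+1 = N] the first and the last are swapped. *)
Lemma c_pmm_exchange k eta : (k < N)%N ->
  c_pmm R k (exchange eta 0 1) = c_pmm R k eta.
Proof.
rewrite leq_eqVlt => /orP[/eqP kN|kN]; last first.
  by apply: eq_big_nat => j jk; rewrite s_prod_exchange // kN.
case: k kN => [|k] kN; first by exfalso; lia.
rewrite /c_pmm !(@big_nat_recr _ _ _ k.+2) //= !(@big_ltn _ _ _ 1 k.+2) //.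
have := s_prod_exchange_wrap (exchange eta 0 1) kN; rewrite exchangeK => <-.
rewrite -(s_prod_exchange_wrap _ kN) addrAC -[RHS]addrAC (addrC (s_prod _ _ _ _)).
congr (_ + _).
apply: eq_big_nat => j jk; rewrite s_prod_exchange //; lia.
Qed.

Lemma flip_exchange x y eta : flip (exchange eta x y) = exchange (flip eta) x y.
Proof. by apply/ffunP => z; rewrite !ffunE. Qed.

Lemma shift_exchange x eta :
  shift x (exchange eta x (x + 1)) = exchange (shift x eta) 0 1.
Proof.
apply/ffunP => z; rewrite !ffunE; congr (eta _).
by have := inj_tperm 0 1 z (addrI x); rewrite addr0 => ->.
Qed.

Lemma c_rate_exchange (m : R) l eta : (l <= N)%N ->
  c_rate m l (exchange eta 0 1) = c_rate m l eta.
Proof.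
move=> lN; apply: eq_big_nat => k kl.
by rewrite flip_exchange c_pmm_exchange //; lia.
Qed.

Lemma a_rate_exchange eta : a_rate R (exchange eta 0 1) = a_rate R eta.
Proof. by rewrite /a_rate /occ !ffunE tpermL tpermR addrC. Qed.

Lemma bernoulli_product_exchange (rho : R) x y eta :
  bernoulli_product rho (exchange eta x y) = bernoulli_product rho eta.
Proof.
rewrite /bernoulli_product [RHS](reindex_inj (@perm_inj _ (tperm x y))) /=.
by apply: eq_bigr => z _; rewrite ffunE.
Qed.

Lemma integral_generator (m rho : R) l f : (l <= N)%N ->
  integral_pmf (@bernoulli_product R N rho) (generator m l f) = 0.
Proof.
move=> lN; rewrite /integral_pmf /generator.
under eq_bigr => eta _ do rewrite mulr_sumr.
rewrite exchange_big big1 // => x _.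
rewrite /nabla.
under eq_bigr => eta _ do rewrite mulrBr mulrBr.
(* Reindexing the gain term by the exchange, an involution, turns it into the loss term. *)
rewrite sumrB [X in X - _](reindex_inj (can_inj (exchangeK x (x + 1)))) /=.
apply/eqP; rewrite subr_eq0; apply/eqP/eq_bigr => eta _.
rewrite bernoulli_product_exchange shift_exchange.
by rewrite c_rate_exchange // a_rate_exchange exchangeK.
Qed.

End Exchange.

(** * From the generator to the semigroup *)

Section Semigroup.
Local Open Scope classical_set_scope.
Local Open Scope ring_scope.
Variables (R : realType) (S : finType).

(** The bound gives [C ^+ n * M] for the [n]-th iterate, so the exponential series converges at each
    state and its limit commutes with the finite sum against [nu]. *)
Lemma invariant_measure_bounded (L : (S -> R) -> S -> R) (nu : S -> R) (C : R) :
  (forall f (M : R), (forall s, `|f s| <= M) -> forall s, `|L f s| <= C * M) ->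
  (forall f, integral_pmf nu (L f) = 0) ->
  invariant_measure L nu.
Proof.
move=> Lbd L0 t f t0.
pose M : R := \sum_s `|f s|.
have fM s : `|f s| <= M by rewrite /M (bigD1 s) //= lerDl sumr_ge0.
have iterM n s : `|iter n L f s| <= C ^+ n * M.
  elim: n s => [|n IH] s; first by rewrite expr0 mul1r.
  by rewrite iterS exprS -mulrA; exact: Lbd.
have cvg s : cvgn (series (fun n => exp_coeff t n * iter n L f s)).
  apply: normed_cvg; rewrite /normed_series_of /=.
  apply: (@series_le_cvg _ _ (fun n => M * exp_coeff (`|C| * t) n)).
  - by [].
  - move=> n; apply: mulr_ge0; last by rewrite exp_coeff_ge0 // mulr_ge0.
    by apply: sumr_ge0.
  - move=> n /=; rewrite normrM ger0_norm ?exp_coeff_ge0 //.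
    have M0 : 0 <= M by apply: sumr_ge0.
    rewrite [in leRHS]/exp_coeff /= exprMn.
    have -> : M * (`|C| ^+ n * t ^+ n / n`!%:R) = exp_coeff t n * (`|C| ^+ n * M).
      by rewrite /exp_coeff /=; ring.
    rewrite ler_wpM2l ?exp_coeff_ge0 // (le_trans (iterM n s)) // ler_wpM2r //.
    by rewrite -normrX ler_norm.
  apply: (@is_cvg_seriesZ _ _ M); exact: is_cvg_series_exp_coeff.
pose u s := series (fun n => exp_coeff t n * iter n L f s).
have lim1 : (fun n => \sum_s nu s * u s n) @ \oo --> integral_pmf nu (semigroup L t f).
  apply: cvg_big => [|s _]; first exact: add_continuous.
  by apply: cvgMl_tmp; exact: cvg.
(* From [n = 1] on the integrated partial sums are constant: the term of index 0 gives [f], and each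
   later one is the integral of an image of [L]. *)
have lim2 : (fun n => \sum_s nu s * u s n) @ \oo --> integral_pmf nu f.
  apply: cvg_near_cst; near=> n.
  have n0 : (0 < n)%N by near: n; exists 1%N.
  rewrite -(prednK n0).
  under eq_bigr => s _ do rewrite /u /series /= mulr_sumr.
  rewrite exchange_big big_nat_recl //= [X in _ + X]big1_seq => [|k _].
    rewrite addr0; apply: eq_bigr => s _.
    by rewrite /exp_coeff /= expr0 fact0 divr1 mul1r.
  transitivity (exp_coeff t k.+1 * integral_pmf nu (L (iter k L f))).
    by rewrite mulr_sumr; apply: eq_bigr => s _; ring.
  by rewrite L0 mulr0.
exact: (cvg_unique _ lim1 lim2).
Unshelve. all: by end_near. Qed.
End Semigroup.

(** The factor 2 bounds the difference in [nabla]; the sum over all [eta] stands in for a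
    maximum. *)
Lemma generator_bounded (R : realType) N (m : R) l (f : config N -> R) M :
  (forall s, `|f s| <= M) -> forall s, `|generator m l f s| <=
  (\sum_(eta : config N) \sum_x
     `|c_rate m l (shift x eta) * a_rate R (shift x eta)| * 2) * M.
Proof.
move=> fM s.
have M0 : 0 <= M by apply: le_trans (fM s).
apply: (@le_trans _ _
  ((\sum_x `|c_rate m l (shift x s) * a_rate R (shift x s)| * 2) * M)).
  rewrite mulr_suml; apply: le_trans (ler_norm_sum _ _ _) _.
  apply: ler_sum => x _; rewrite normrM -mulrA ler_wpM2l //.
  rewrite /nabla (le_trans (ler_normB _ _)) //.
  by have := fM s; have := fM (exchange s x (x + 1)); lra.
rewrite ler_wpM2r // (bigD1 s) //= lerDl.
by apply: sumr_ge0 => eta _; apply: sumr_ge0 => x _; rewrite mulr_ge0.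
Qed.

(** * Connecting configurations by jumps *)

Section Irreducibility.
Variables (R : realType) (m : R) (N l : nat).
Hypotheses (hm : 0 < m < 2) (l0 : (0 < l)%N).
Implicit Types eta xi : config N.

Local Notation conn := (connect (positive_jump (@generator R N m l))).

Lemma a_rate_ge0 eta : 0 <= a_rate R eta.
Proof. by rewrite /a_rate /occ; case: (eta 0); case: (eta 1); rewrite /=; lra. Qed.

Lemma connect_adjacent eta x : conn eta (exchange eta x (x + 1)).
Proof.
have [->|ne] := eqVneq (exchange eta x (x + 1)) eta; first exact: connect0.
apply: connect1; rewrite /positive_jump eq_sym ne /= /jump_rate /generator.
(* All edges contribute nonnegatively to this jump, so positivity of the term at [x] suffices. *)
rewrite (bigD1 x) //=; apply: ltr_wpDr.
  apply: sumr_ge0 => y _; rewrite !mulr_ge0 ?a_rate_ge0 //.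
    by rewrite ltW // c_rate_gt0.
  by rewrite /nabla (negPf (_ : eta != _)) 1?eq_sym // subr0 ler0n.
have neq : eta x != eta (x + 1).
  apply: contraNneq ne => e; apply/eqP/ffunP => z; rewrite ffunE.
  by case: tpermP => [->|->|].
rewrite /nabla eqxx (negPf (_ : eta != _)) 1?eq_sym // subr0 mulr1.
rewrite mulr_gt0 ?c_rate_gt0 // /a_rate /occ !ffunE addr0.
by move: neq; case: (eta x); case: (eta (x + 1)) => //= _; lra.
Qed.

(** Induction on the distance from [x] to [y]: conjugating the transposition of [x] and [z] by that
    of [z] and [z + 1] gives that of [x] and [z + 1]. *)
Lemma connect_exchange eta x y : conn eta (exchange eta x y).
Proof.
have exchangexx eta' z : exchange eta' z z = eta'.
  by apply/ffunP => u; rewrite ffunE tperm1 perm1.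
rewrite -[y](addrNK x) addrC -[y - x]natr_Zp.
elim: (nat_of_ord _) eta => [|d IH] eta; first by rewrite addr0 exchangexx connect0.
rewrite -natr1 addrA; set z := x + d%:R in IH *.
(* The conjugation needs [x] distinct from [z] and [z + 1]; the latter can fail by wrapping
   around. *)
have [->|xz] := eqVneq x z; first exact: connect_adjacent.
have [<-|xz1] := eqVneq x (z + 1); first by rewrite exchangexx connect0.
have -> : exchange eta x (z + 1) =
    exchange (exchange (exchange eta z (z + 1)) x z) z (z + 1).
  apply/ffunP => u; rewrite !ffunE; congr (eta _).
  rewrite (inj_tperm x z _ (@perm_inj _ (tperm z (z + 1)))) tpermK tpermL.
  by rewrite [tperm z _ x]tpermD // eq_sym.
apply: connect_trans (connect_adjacent _ _).
by apply: connect_trans (IH _); exact: connect_adjacent.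
Qed.

(* Exchanging a particle of [eta] missing in [xi] with a hole of [eta] filled in
   [xi] repairs two of the sites where [eta] and [xi] differ. *)
Lemma hyperplane_irreducible k :
  irreducible_class (@generator R N m l) (hyperplane N k).
Proof.
move=> eta xi; rewrite !inE => /eqP eta_k /eqP xi_k.
have [n] := ubnP #|[set x | eta x != xi x]|.
elim: n eta eta_k => // n IH eta eta_k; rewrite ltnS => diff_n.
have [->|ne] := eqVneq eta xi; first exact: connect0.
have eq_sum : (\sum_x eta x = \sum_x xi x)%N by rewrite eta_k xi_k.
have imbalance (z1 z2 : config N) : z1 != z2 -> (\sum_x z1 x = \sum_x z2 x)%N ->
    exists x, z1 x && ~~ z2 x.
  move=> ne12 eq12; apply/existsP; apply: contra_neqT ne12; rewrite negb_exists.
  move=> /forallP le12; apply/ffunP => x.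
  have le y : (z1 y <= z2 y)%N by have := le12 y; case: (z1 y); case: (z2 y).
  (* Pointwise inequality with equal sums forces equality at every site. *)
  have := leqif_sum (fun y (_ : true) => leqif_eq (le y)).
  case=> _; rewrite eq12 eqxx => /esym/forallP/(_ x).
  by case: (z1 x); case: (z2 x).
have [x /andP[ex xx]] := imbalance _ _ ne eq_sum.
rewrite eq_sym in ne; have [y /andP[xy ey]] := imbalance _ _ ne (esym eq_sum).
apply: connect_trans (connect_exchange eta x y) (IH _ _ _).
  by rewrite -eta_k [RHS](reindex_inj (@perm_inj _ (tperm x y))) /=;
     apply: eq_bigr => z _; rewrite ffunE.
(* No site joins the set of disagreements, and [x] leaves it. *)
apply: leq_trans diff_n; apply: proper_card; apply/properP; split; last first.
  by exists x; rewrite !inE ?ffunE ?tpermL ?ex ?(negPf xx) ?(negPf ey).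
apply/fintype.subsetP => z; rewrite !inE ffunE.
by case: tpermP => [->|->|//]; rewrite ?ex ?xy ?(negPf ey) ?(negPf xx).
Qed.
End Irreducibility.

Theorem lemma2p14 (R : realType) (m : R) (N l : nat)
    (hm : 0 < m < 2) (hl : (2 <= l <= N)%N) :
  (forall rho : R, 0 <= rho <= 1 ->
     invariant_measure (@generator R N m l) (@bernoulli_product R N rho)) /\
  (forall k : nat, (k <= N)%N ->
     irreducible_class (@generator R N m l) (hyperplane N k)).
Proof.
have /andP[l2 lN] := hl; split=> [rho _|k _].
  apply: invariant_measure_bounded => f; first exact: generator_bounded.
  by apply: integral_generator => //; exact: leq_trans lN.
by apply: hyperplane_irreducible => //; exact: ltnW.
Qed.
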